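(* Let $H\in\mathbb{R}^{n\times d}$ have rank $h$, $\Sigma\in\mathbb{R}^{n\times n}$ symmetric positive definite, $y\in\mathbb{R}^n$, $J\ge2$, and fix an initial ensemble $v_0^{(1)},\dots,v_0^{(J)}\in\mathbb{R}^d$ with empirical covariance $\Gamma_0$. Let $\varepsilon_i^{(j)}$, $i\ge0$, $j=1,\dots,J$, be i.i.d. $\mathcal{N}(0,\Sigma)$ random vectors. Define $C_0=H\Gamma_0H^\top$, $C_{i+1}=\Sigma-\Sigma(C_i+\Sigma)^{-1}\Sigma$, $\widetilde{\mathcal{M}}_i=\Sigma(C_i+\Sigma)^{-1}$, and the idealized misfits $$\tilde\theta_0^{(j)}=Hv_0^{(j)}-y,\qquad \tilde\theta_{i+1}^{(j)}=\widetilde{\mathcal{M}}_i\tilde\theta_i^{(j)}+(I-\widetilde{\mathcal{M}}_i)\varepsilon_i^{(j)}.$$ With $\widetilde{\mathcal{P}},\widetilde{\mathcal{Q}},\widetilde{\mathcal{N}}$ as defined in the context, for every $j=1,\dots,J$: (a) $\mathbb{E}[\|\widetilde{\mathcal{P}}\tilde\theta_i^{(j)}\|]=\mathcal{O}(i^{-1/2})$ as $i\to\infty$; (b) $\widetilde{\mathcal{Q}}\tilde\theta_i^{(j)}=\widetilde{\mathcal{Q}}\tilde\theta_0^{(j)}$ for all $i\ge0$; (c) $\widetilde{\mathcal{N}}\tilde\theta_i^{(j)}=\widetilde{\mathcal{N}}\tilde\theta_0^{(j)}$ for all $i\ge0$.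
   Context: Empirical covariance: $\Gamma_0=\frac1{J-1}\sum_j(v_0^{(j)}-\bar v_0)(v_0^{(j)}-\bar v_0)^\top$, $\bar v_0=\frac1J\sum_jv_0^{(j)}$. Let $r$ be the number of positive eigenvalues of the pencil $C_0\tilde w=\tilde\delta\Sigma\tilde w$. Let $\tilde w_1,\dots,\tilde w_n$ be a basis of $\mathbb{R}^n$ with $\tilde w_k^\top\Sigma\tilde w_l$ equal to $1$ if $k=l$ and $0$ otherwise, such that each $\tilde w_\ell$ is a generalized eigenvector of $(C_i,\Sigma)$ for every $i\ge0$; $\tilde w_1,\dots,\tilde w_r\in\mathsf{Ran}(\Sigma^{-1}H)$ correspond to positive eigenvalues; $\tilde w_{r+1},\dots,\tilde w_h\in\mathsf{Ran}(\Sigma^{-1}H)$ correspond to eigenvalue zero; $\tilde w_{h+1},\dots,\tilde w_n\in\mathsf{Ker}(H^\top)$ correspond to eigenvalue zero. With $\widetilde W=[\tilde w_1,\dots,\tilde w_n]$ and $\widetilde W_{k:l}$ its columns $k$ through $l$, set $\widetilde{\mathcal{P}}=\Sigma\widetilde W_{1:r}\widetilde W_{1:r}^\top$, $\widetilde{\mathcal{Q}}=\Sigma\widetilde W_{r+1:h}\widetilde W_{r+1:h}^\top$, $\widetilde{\mathcal{N}}=\Sigma\widetilde W_{h+1:n}\widetilde W_{h+1:n}^\top$. The expectation is over the perturbations $\varepsilon_i^{(j)}$. *)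

(* Defs.v *)
From HB Require Import structures.
From mathcomp Require Import all_boot all_order all_algebra.
From mathcomp Require Import all_classical all_reals all_analysis.
Set Implicit Arguments. Unset Strict Implicit. Unset Printing Implicit Defensive.
Import Order.TTheory GRing.Theory Num.Theory.
Local Open Scope classical_set_scope.
Local Open Scope ring_scope.

Section Defs.
Context {R : realType}.

Definition eucl_norm {n : nat} (x : 'cV[R]_n) : R :=
  Num.sqrt (\sum_(c < n) x c 0 ^+ 2).

Definition ens_mean {d J : nat} (v : 'I_J -> 'cV[R]_d) : 'cV[R]_d :=
  J%:R^-1 *: \sum_(j < J) v j.
Definition emp_cov {d J : nat} (v : 'I_J -> 'cV[R]_d) : 'M[R]_d :=
  (J%:R - 1)^-1 *: \sum_(j < J) ((v j - ens_mean v) *m (v j - ens_mean v)^T).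

Fixpoint Cseq {n : nat} (C0 Sig : 'M[R]_n) (i : nat) : 'M[R]_n :=
  match i with
  | 0 => C0
  | i'.+1 => Sig - Sig *m invmx (Cseq C0 Sig i' + Sig) *m Sig
  end.

Definition Mt {n : nat} (C0 Sig : 'M[R]_n) (i : nat) : 'M[R]_n :=
  Sig *m invmx (Cseq C0 Sig i + Sig).

Fixpoint theta {T : Type} {n J : nat} (C0 Sig : 'M[R]_n) (th0 : 'I_J -> 'cV[R]_n)
  (eps : nat -> 'I_J -> T -> 'cV[R]_n) (i : nat) (j : 'I_J) (w : T) : 'cV[R]_n :=
  match i with
  | 0 => th0 j
  | i'.+1 => Mt C0 Sig i' *m theta C0 Sig th0 eps i' j w
             + (1%:M - Mt C0 Sig i') *m eps i' j w
  end.

Definition proj_block {n : nat} (Sig W : 'M[R]_n) (lo hi : nat) : 'M[R]_n :=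
  Sig *m \sum_(l < n | (lo <= l < hi)%N) (col l W *m (col l W)^T).

(* A family of random vectors in R^n that are i.i.d. N(0, Sig).
   - each coordinate is measurable;
   - Gaussian N(0,Sig): every nonzero linear functional u^T X is a real
     normal random variable with mean 0 and variance u^T Sig u;
   - mutual independence: product rule on every finite subfamily, for
     events given by Borel rectangles in the coordinates (a pi-system
     generating the sigma-algebra of each random vector). *)
Definition rect_event {T I : Type} {n : nat} (X : I -> T -> 'cV[R]_n)
  (B : I -> 'I_n -> set R) (k : I) : set T :=
  [set w | forall c : 'I_n, B k c (X k w c 0)].

Definition iid_gaussian {d : measure_display} {T : measurableType d} {I : eqType}
  {n : nat} (P : probability T R) (Sig : 'M[R]_n) (X : I -> T -> 'cV[R]_n) : Prop :=
  [/\ (forall k (c : 'I_n), measurable_fun setT (fun w => X k w c 0)),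
      (forall k (u : 'cV[R]_n), u != 0 -> forall A : set R, measurable A ->
          P ((fun w => (u^T *m X k w) 0 0) @^-1` A)
          = normal_prob 0 (Num.sqrt ((u^T *m Sig *m u) 0 0)) A) &
      (forall (F : seq I) (B : I -> 'I_n -> set R),
          uniq F -> (forall k c, measurable (B k c)) ->
          P (\bigcap_(k in [set` F]) rect_event X B k)
          = (\prod_(k <- F) P (rect_event X B k))%E)].

End Defs.

(* Main.v *)
Require Import Defs.
From HB Require Import structures.
From mathcomp Require Import all_boot all_order all_algebra.
From mathcomp Require Import all_classical all_reals all_analysis.
From mathcomp Require Import measurable_realfun ring lra.
Import Order.TTheory GRing.Theory Num.Theory.
Local Open Scope classical_set_scope.
Local Open Scope ring_scope.

(* Since W^T Sig W = 1, every C_i is Sig W diag(lam_l / (1 + i lam_l)) W^T Sig,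
   so the coordinates x_i = w_l^T theta_i decouple:
     (1 + (i+1) lam) x_{i+1} = (1 + i lam) x_i + lam xi_i,  xi_i = w_l^T eps_i,
   i.e. x_i = (x_0 + lam (xi_0 + ... + xi_{i-1})) / (1 + i lam).  For lam = 0 this is
   constant, which gives (b) and (c).  For lam > 0 the xi_k are centered and
   uncorrelated with a common finite second moment m, so the sum has second moment
   i m, hence E x_i^2 = O(1/i) and E |x_i| = O(i^{-1/2}).  Independence is only
   given on coordinate rectangles; by bilinearity of the covariance, uncorrelated
   coordinates are all that is needed. *)

(** * Second moment of a centered normal law *)

(** The normal law is absolutely continuous with respect to Lebesgue measure, and its Radon-Nikodym
    derivative agrees almost everywhere with [normal_pdf], since both have the same integral over
    every measurable set. *)
Lemma ge0_integral_normal_prob {R : realType} (m s : R) (f : R -> \bar R) :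
  measurable_fun setT f -> (forall x, 0 <= f x)%E ->
  (\int[normal_prob m s]_x f x =
   \int[lebesgue_measure]_x (f x * (normal_pdf m s x)%:E))%E.
Proof.
move=> mf f0.
pose nu : probability (measurableTypeR R) R := normal_prob m s.
have numu : nu `<< lebesgue_measure by exact: normal_prob_dominates.
rewrite -(Radon_Nikodym_SigmaFinite.change_of_variables numu f0 measurableT mf).
have rnf : (lebesgue_measure.-integrable setT
    (Radon_Nikodym_SigmaFinite.f nu lebesgue_measure)).
  exact: Radon_Nikodym_SigmaFinite.f_integrable.
apply: ae_eq_integral => //.
- apply: emeasurable_funM => //; exact: measurable_int rnf.
- apply: emeasurable_funM => //; apply/measurable_EFinP.
  exact: measurable_normal_pdf.
- apply: ae_eqe_mul2l.
  apply: integral_ae_eq => //.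
    by apply/measurable_EFinP; exact: measurable_normal_pdf.
  by move=> E _ mE; rewrite -Radon_Nikodym_SigmaFinite.f_integral.
Qed.

(* [x ^+ 2 <= 4 s ^+ 2 expR (x ^+ 2 / (4 s ^+ 2))] trades the factor [x ^+ 2]
   for a Gaussian density of twice the variance. *)
Lemma normal_prob_moment2_lty {R : realType} (s : R) : 0 < s ->
  (\int[normal_prob 0 s]_x (x ^+ 2)%:E < +oo)%E.
Proof.
move=> s0.
rewrite ge0_integral_normal_prob; last 2 first.
- by apply/measurable_EFinP; exact: measurable_funX.
- by move=> x; rewrite lee_fin sqr_ge0.
pose s' := s * Num.sqrt 2.
have s'0 : 0 < s' by rewrite mulr_gt0// sqrtr_gt0.
have s'2 : s' ^+ 2 = s ^+ 2 * 2 by rewrite exprMn sqr_sqrtr.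
(* [c] absorbs the ratio of the two peaks, so that only exponentials remain to be compared. *)
pose c := 4 * s ^+ 2 * normal_peak s / normal_peak s'.
have ub x : x ^+ 2 * normal_pdf 0 s x <= c * normal_pdf 0 s' x.
  have p0 := normal_peak_gt0 (lt0r_neq0 s'0).
  have cE : c * normal_peak s' = 4 * s ^+ 2 * normal_peak s by rewrite divfK ?gt_eqF.
  rewrite !normal_pdfE ?gt_eqF// [leRHS]mulrA cE.
  rewrite mulrCA [leRHS]mulrAC mulrC ler_wpM2r ?normal_peak_ge0//.
  rewrite /normal_fun subr0 s'2.
  set q := x ^+ 2 / (4 * s ^+ 2).
  have s20 : s != 0 by rewrite gt_eqF.
  have -> : - x ^+ 2 / (s ^+ 2 *+ 2) = - q - q by rewrite /q; field.
  have -> : - x ^+ 2 / (s ^+ 2 * 2 *+ 2) = - q by rewrite /q; field.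
  have -> : x ^+ 2 = 4 * s ^+ 2 * q by rewrite /q; field.
  have s4 : 0 <= 4 * s ^+ 2 by rewrite pmulr_rge0 ?sqr_ge0.
  rewrite expRD -[leLHS]mulrA ler_wpM2l// mulrA.
  rewrite ler_piMl ?expR_ge0//.
  rewrite expRN ler_pdivrMr ?expR_gt0// mul1r.
  by rewrite (le_trans _ (expR_ge1Dx q))// lerDr.
have mpdf t : measurable_fun setT (fun x => (normal_pdf 0 t x)%:E).
  by apply/measurable_EFinP; exact: measurable_normal_pdf.
have c0 : 0 <= c.
  rewrite divr_ge0 ?normal_peak_ge0// mulr_ge0 ?normal_peak_ge0//.
  by rewrite pmulr_rge0 ?sqr_ge0.
apply: (@le_lt_trans _ _ (\int[lebesgue_measure]_x (c%:E * (normal_pdf 0 s' x)%:E)))%E.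
  apply: ge0_le_integral => //.
  - by move=> x _; rewrite -EFinM lee_fin mulr_ge0 ?sqr_ge0 ?normal_pdf_ge0.
  - apply: emeasurable_funM; apply/measurable_EFinP; first exact: measurable_funX.
    exact: measurable_normal_pdf.
  - by apply: emeasurable_funM => //; exact: mpdf.
  - by move=> x _; rewrite -!EFinM lee_fin.
rewrite ge0_integralZl//; last 2 first.
- exact: mpdf.
- by move=> x _; rewrite lee_fin normal_pdf_ge0.
by rewrite integral_normal_pdf mule1 ltry.
Qed.

(** * Square-integrable variables and uncorrelated sums *)

Lemma Lfun2P {d} {T : measurableType d} {R : realType} (P : probability T R)
    (X : T -> R) :
  measurable_fun setT X -> (\int[P]_x ((X x) ^+ 2)%:E < +oo)%E ->
  X \in Lfun P 2%:E.
Proof.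
move=> mX X2; rewrite inE; apply/andP; split; rewrite inE//=.
rewrite /finite_norm unlock poweR_lty//.
under eq_integral => x _ do rewrite /= powR_mulrn// real_normK ?num_real//.
exact: X2.
Qed.

(* The joint law is the product of the marginals, hence Fubini applies. *)
Lemma covariance_indep {d} {T : measurableType d} {R : realType}
    (P : probability T R) (X Y : T -> R) :
  X \in Lfun P 2%:E -> Y \in Lfun P 2%:E ->
  (forall A B : set R, measurable A -> measurable B ->
     P (X @^-1` A `&` Y @^-1` B) = P (X @^-1` A) * P (Y @^-1` B))%E ->
  covariance P X Y = 0%E.
Proof.
move=> X2 Y2 XY.
have Pfin : P setT \is a fin_num := fin_num_measure P _ measurableT.
have X1 := Lfun_subset12 Pfin X2.
have Y1 := Lfun_subset12 Pfin Y2.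
have XY1 := Lfun2_mul_Lfun1 X2 Y2.
have mX : measurable_fun setT X by move/sub_Lfun_mfun: X2; rewrite inE.
have mY : measurable_fun setT Y by move/sub_Lfun_mfun: Y2; rewrite inE.
pose X' : {mfun T >-> R} := HB.pack X (isMeasurableFun.Build _ _ _ _ _ mX).
pose Y' : {mfun T >-> R} := HB.pack Y (isMeasurableFun.Build _ _ _ _ _ mY).
pose Z w : R * R := (X w, Y w).
have mZ : measurable_fun setT Z by apply: measurable_fun_pair.
pose Z' : {mfun T >-> (R * R)%type} :=
  HB.pack Z (isMeasurableFun.Build _ _ _ _ _ mZ).
pose m1 : probability _ R := distribution P X'.
pose m2 : probability _ R := distribution P Y'.
pose f (z : R * R) := (z.1 * z.2)%:E.
have mf : measurable_fun setT f.
  by apply/measurable_EFinP/measurable_funM.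
have joint A : measurable A -> (m1 \x m2)%E A = distribution P Z' A.
  apply: product_measure_unique => A0 B0 mA mB.
  by rewrite /m1 /m2 /distribution /pushforward /= -XY.
have iX : P.-integrable setT (EFin \o X) by exact/Lfun1_integrable.
have iY : P.-integrable setT (EFin \o Y) by exact/Lfun1_integrable.
have iXY : P.-integrable setT (f \o Z) by exact/Lfun1_integrable.
have iY' : m2.-integrable setT EFin.
  by apply: integrable_pushforward => //; exact: measurable_EFin.
have iZ : (distribution P Z').-integrable setT f.
  by apply: integrable_pushforward.
(* Fubini needs integrability under the product measure; it is inherited from that of [X * Y]
   because the two laws on the plane coincide. *)
have fint : (m1 \x m2)%E.-integrable setT f.
  apply/integrableP; split => //.
  case/integrableP: iZ => _; rewrite (@eq_measure_integral _ _ _ _ (m1 \x m2)%E) // => A mA _.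
  exact/esym/joint.
rewrite covarianceE//.
have -> : ('E_P[X * Y] = 'E_P[X] * 'E_P[Y])%E.
  rewrite unlock.
  transitivity (\int[(m1 \x m2)%E]_z f z)%E.
    transitivity (\int[distribution P Z']_z f z)%E.
      by rewrite integral_distribution.
    apply: eq_measure_integral => A mA _; exact/esym/joint.
  rewrite -(integral12_prod_meas1 fint) /fubini_F /=.
  have [b EYb] : exists b, (\int[P]_w (Y w)%:E = b%:E)%E.
    by exists (fine (\int[P]_w (Y w)%:E)); rewrite fineK// integrable_fin_num.
  have EY : (\int[m2]_y y%:E = b%:E)%E.
    by rewrite -EYb integral_distribution//; exact: measurable_EFin.
  have EX : (\int[m1]_x x%:E = \int[P]_w (X w)%:E)%E.
    by rewrite integral_distribution//; exact: measurable_EFin.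
  under eq_integral => x _ do rewrite (eq_integral (fun y => x%:E * y%:E)%E) // integralZl// EY.
  rewrite EYb -EX integralZr//.
  by apply: integrable_pushforward => //; exact: measurable_EFin.
by rewrite subee// fin_numM// expectation_fin_num.
Qed.

Lemma Lfun2_sum {d} {T : measurableType d} {R : realType} (P : probability T R)
    {I : Type} (r : seq I) (F : I -> T -> R) :
  (forall i, F i \in Lfun P 2%:E) ->
  (fun w => \sum_(i <- r) F i w) \in Lfun P 2%:E.
Proof.
move=> F2; have -> : (fun w => \sum_(i <- r) F i w) = \sum_(i <- r) F i.
  by apply/funext => w; rewrite fct_sumE.
by rewrite rpred_sum ?lee1n.
Qed.

Lemma covariance_suml_eq0 {d} {T : measurableType d} {R : realType}
    (P : probability T R) {I : Type} (r : seq I) (F : I -> T -> R) (Y : T -> R) :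
  (forall i, F i \in Lfun P 2%:E) -> Y \in Lfun P 2%:E ->
  (forall i, covariance P (F i) Y = 0%E) ->
  covariance P (fun w => \sum_(i <- r) F i w) Y = 0%E.
Proof.
move=> F2 Y2 FY; elim: r => [|i r IHr].
  rewrite (_ : (fun w => _) = cst 0) ?covariance_cst_l//.
  by apply/funext => w; rewrite big_nil.
rewrite (_ : (fun w => _) = F i \+ (fun w => \sum_(i <- r) F i w)).
  by rewrite covarianceDl ?Lfun2_sum// FY IHr adde0.
by apply/funext => w; rewrite big_cons.
Qed.

(** The partial sums are centered, so their second moment is their variance; each new summand adds
    [m], its covariance with the preceding sum being zero. *)
Lemma expectation_sqr_sum {d} {T : measurableType d} {R : realType}
    (P : probability T R) (Z : nat -> T -> R) (m : R) :
  (forall k, Z k \in Lfun P 2%:E) -> (forall k, 'E_P[Z k] = 0)%E ->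
  (forall k, 'E_P[(Z k ^+ 2)%R] = m%:E)%E ->
  (forall k l, k != l -> covariance P (Z k) (Z l) = 0)%E ->
  forall i, ('E_P[fun w => ((\sum_(k < i) Z k w) ^+ 2)%R] = (i%:R * m)%:E)%E.
Proof.
move=> Z2 EZ EZ2 cZ i.
have Pfin : P setT \is a fin_num := fin_num_measure P _ measurableT.
pose S j w := \sum_(k < j) Z k w.
have S2 j : S j \in Lfun P 2%:E by exact: Lfun2_sum.
have SS j : S j.+1 = S j \+ Z j by apply/funext => w; rewrite /S big_ord_recr.
have S0 : S 0 = cst 0 by apply/funext => w; rewrite /S big_ord0.
have ES j : ('E_P[S j] = 0)%E.
  elim: j => [|j IHj]; first by rewrite S0 expectation_cst.
  by rewrite SS expectationD ?Lfun_subset12// IHj EZ adde0.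
have VZ k : variance P (Z k) = m%:E by rewrite varianceE// EZ EZ2 expe2 mul0e sube0.
rewrite -[LHS]/('E_P[(S i ^+ 2)%R])%E.
transitivity (variance P (S i)); first by rewrite varianceE// ES expe2 mul0e sube0.
elim: i => [|i IHi]; first by rewrite S0 variance_cst mul0r.
rewrite SS varianceD// IHi VZ covariance_suml_eq0//; last first.
  by move=> k; apply: cZ; rewrite neq_ltn ltn_ord.
by rewrite mule0 adde0 -EFinD -natr1 mulrDl mul1r.
Qed.

(** Both sides integrate the square against the law of [X], once on [T] and once on the real
    line. *)
Lemma normal_law_moment2 {d} {T : measurableType d} {R : realType}
    (P : probability T R) (X : T -> R) (s : R) :
  measurable_fun setT X ->
  (forall A : set R, measurable A -> P (X @^-1` A) = normal_prob 0 s A) ->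
  ('E_P[(X ^+ 2)%R] = \int[normal_prob 0 s]_x (x ^+ 2)%:E)%E.
Proof.
move=> mX lawX; rewrite unlock.
have mX' : measurable_fun (U := measurableTypeR R) setT X by exact: mX.
pose X' : {mfun T >-> measurableTypeR R} :=
  HB.pack X (isMeasurableFun.Build _ _ _ _ _ mX').
transitivity (\int[distribution P X']_x (x ^+ 2)%:E)%E.
  rewrite ge0_integral_distribution//.
    by apply/measurable_EFinP; exact: measurable_funX.
  by move=> x; rewrite lee_fin sqr_ge0.
by apply: eq_measure_integral => A mA _; exact: lawX.
Qed.

Lemma eq_law_expectation {d} {T : measurableType d} {R : realType}
    (P : probability T R) (X Y : T -> R) :
  X \in Lfun P 1 -> Y \in Lfun P 1 ->
  (forall A : set R, measurable A -> P (X @^-1` A) = P (Y @^-1` A)) ->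
  ('E_P[X] = 'E_P[Y])%E.
Proof.
move=> X1 Y1 XY; rewrite unlock.
have mX : measurable_fun setT X by move/sub_Lfun_mfun: X1; rewrite inE.
have mY : measurable_fun setT Y by move/sub_Lfun_mfun: Y1; rewrite inE.
have iX : P.-integrable setT (EFin \o X) by exact/Lfun1_integrable.
have iY : P.-integrable setT (EFin \o Y) by exact/Lfun1_integrable.
pose X' : {mfun T >-> R} := HB.pack X (isMeasurableFun.Build _ _ _ _ _ mX).
pose Y' : {mfun T >-> R} := HB.pack Y (isMeasurableFun.Build _ _ _ _ _ mY).
have <- : (\int[distribution P X']_x x%:E = \int[P]_w (X w)%:E)%E.
  by rewrite integral_distribution//; exact: measurable_EFin.
have <- : (\int[distribution P Y']_x x%:E = \int[P]_w (Y w)%:E)%E.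
  by rewrite integral_distribution//; exact: measurable_EFin.
by apply: eq_measure_integral => A mA _; exact: XY.
Qed.

(** * Linear functionals of the Gaussian family *)

Section iid_gaussian.
Context {d : measure_display} {T : measurableType d} {R : realType} {I : eqType}
  {n : nat} (P : probability T R) (Sig : 'M[R]_n) (X : I -> T -> 'cV[R]_n).
Hypothesis Sig_gt0 : forall u : 'cV[R]_n, u != 0 -> 0 < (u^T *m Sig *m u) 0 0.
Hypothesis iidX : iid_gaussian P Sig X.

Let lin k (u : 'cV[R]_n) w : R := (u^T *m X k w) 0 0.

Let linE k u w : lin k u w = \sum_(c < n) u c 0 * X k w c 0.
Proof. by rewrite /lin mxE; apply: eq_bigr => c _; rewrite mxE. Qed.

Lemma gaussian_lin_measurable k (u : 'cV[R]_n) : measurable_fun setT (lin k u).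
Proof.
case: iidX => mX _ _.
rewrite (_ : lin k u = fun w => \sum_(c < n) u c 0 * X k w c 0).
  by apply: measurable_sum => c; exact: measurable_funM.
by apply/funext => w; rewrite linE.
Qed.

Lemma gaussian_lin_moment2 k (u : 'cV[R]_n) : u != 0 ->
  ('E_P[(lin k u ^+ 2)%R] =
   \int[normal_prob 0 (Num.sqrt ((u^T *m Sig *m u) 0 0))%R]_x (x ^+ 2)%:E)%E.
Proof.
case: iidX => _ lawX _ u0; apply: normal_law_moment2.
  exact: gaussian_lin_measurable.
by move=> A mA; exact: lawX.
Qed.

Lemma gaussian_lin_Lfun2 k (u : 'cV[R]_n) : u != 0 -> lin k u \in Lfun P 2%:E.
Proof.
move=> u0; apply: Lfun2P; first exact: gaussian_lin_measurable.
have := gaussian_lin_moment2 k u u0; rewrite unlock => ->.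
by apply: normal_prob_moment2_lty; rewrite sqrtr_gt0 Sig_gt0.
Qed.

(* [lin k u] and [lin k (- u)] have the same law. *)
Lemma gaussian_lin_expectation k (u : 'cV[R]_n) : u != 0 -> ('E_P[lin k u] = 0)%E.
Proof.
move=> u0; have Nu0 : - u != 0 by rewrite oppr_eq0.
have trN : (- u)^T = - u^T by apply/matrixP => a b; rewrite !mxE.
have Pfin : P setT \is a fin_num := fin_num_measure P _ measurableT.
have L1 v : v != 0 -> lin k v \in Lfun P 1.
  by move=> v0; apply: Lfun_subset12 => //; exact: gaussian_lin_Lfun2.
have ENl : ('E_P[lin k u] = 'E_P[lin k (- u)])%E.
  apply: eq_law_expectation; [exact: L1|exact: L1|] => A mA.
  case: iidX => _ lawX _.
  apply: etrans (lawX k u u0 A mA) _; apply: etrans _ (esym (lawX k _ Nu0 A mA)).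
  by rewrite trN mulNmx mulmxN mulNmx opprK.
have Efin := expectation_fin_num (L1 u u0).
have ENr : ('E_P[lin k (- u)] = - 'E_P[lin k u])%E.
  rewrite (_ : lin k (- u) = -1 \o* lin k u).
    by rewrite expectationZl ?L1// EFinN mulN1e.
  by apply/funext => w; rewrite /lin trN mulNmx mxE /= mulrN1.
move: ENl; rewrite ENr -(fineK Efin) => -[] e.
by congr EFin; lra.
Qed.

(** Both functionals are expanded in coordinates, which reduces the claim to one coordinate of [X k]
    against one coordinate of [X l]; for these the product rule on rectangles is exactly
    independence. *)
Lemma gaussian_lin_covariance k l (u v : 'cV[R]_n) : k != l -> u != 0 -> v != 0 ->
  covariance P (lin k u) (lin l v) = 0%E.
Proof.
move=> kl u0 v0.
have delta0 c : delta_mx c 0 != 0 :> 'cV[R]_n.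
  by apply/eqP => /matrixP/(_ c 0)/eqP; rewrite !mxE !eqxx oner_eq0.
have lin_delta m c : lin m (delta_mx c 0) = fun w => X m w c 0.
  by apply/funext => w; rewrite /lin trmx_delta -rowE mxE.
have X2 m c : (fun w => X m w c 0) \in Lfun P 2%:E.
  by rewrite -lin_delta gaussian_lin_Lfun2.
have Z2 (m : I) (w : 'cV[R]_n) c : w c 0 \o* (fun x => X m x c 0) \in Lfun P 2%:E.
  by rewrite Lfun_scale ?X2// ler1n.
have linS m w : lin m w = fun x => \sum_c (w c 0 \o* (fun x => X m x c 0)) x.
  by apply/funext => x; rewrite linE; apply: eq_bigr => c _; rewrite /= mulrC.
have Pfin : P setT \is a fin_num := fin_num_measure P _ measurableT.
rewrite (linS k) covariance_suml_eq0 ?gaussian_lin_Lfun2// => c.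
rewrite covarianceC (linS l) covariance_suml_eq0// => c'.
rewrite covarianceZl ?Lfun2_mul_Lfun1 ?Lfun_subset12 ?Lfun_cst//.
rewrite covarianceZr ?Lfun2_mul_Lfun1 ?Lfun_subset12//.
rewrite covariance_indep ?mule0// => A B mA mB.
case: iidX => _ _ indX.
(* Rectangles with one constrained side each: coordinate [c'] of [X l] lies in [A], coordinate [c]
   of [X k] lies in [B], and every other side is the whole line. *)
pose D (m : I) (e : 'I_n) : set R :=
  if m == l then (if e == c' then A else setT) else (if e == c then B else setT).
have mD m e : measurable (D m e) by rewrite /D; do ! case: ifP.
have Dl : rect_event X D l = (fun w => X l w c' 0) @^-1` A.
  apply/seteqP; split => [w /(_ c')|w Aw e]; rewrite /D !eqxx//.
  by case: eqP => [->|].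
have Dk : rect_event X D k = (fun w => X k w c 0) @^-1` B.
  apply/seteqP; split => [w /(_ c)|w Aw e]; rewrite /D (negbTE kl) ?eqxx//.
  by case: eqP => [->|].
have lk : l != k by rewrite eq_sym.
have /(_ _)/(_ mD) := indX [:: l; k] D; rewrite /= inE lk => /(_ isT).
rewrite !big_cons big_nil mule1 Dl Dk => <-.
congr (P _); rewrite -Dl -Dk; apply/seteqP; split => [w [wl wk] m|w H].
  by rewrite /= !inE => /orP[] /eqP ->.
by split; apply: H; rewrite /= !inE eqxx ?orbT.
Qed.

End iid_gaussian.

Lemma ler_eucl_norm_sum {R : realType} {n : nat} (x : 'cV[R]_n) :
  eucl_norm x <= \sum_(c < n) `|x c 0|.
Proof.
have s0 : 0 <= \sum_(c < n) `|x c 0| by exact: sumr_ge0.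
rewrite -[leRHS]ger0_norm// -sqrtr_sqr; apply: ler_wsqrtr.
rewrite expr2 mulr_suml; apply: ler_sum => c _.
rewrite -real_normK ?num_real// expr2 ler_wpM2l//.
by rewrite (bigD1 c)//= lerDl sumr_ge0.
Qed.

(** * Simultaneous diagonalization of the covariance and misfit recursions *)

Section idealized_misfit.
Context {R : realType} {n : nat} (C0 Sig W : 'M[R]_n) (lam : 'I_n -> R).
Hypothesis W_orth : W^T *m Sig *m W = 1%:M.
Hypothesis lam_ge0 : forall l, 0 <= lam l.
Hypothesis C0_eig : forall l, C0 *m col l W = lam l *: (Sig *m col l W).

Let SWW : Sig *m W *m W^T = 1%:M.
Proof. by apply: mulmx1C; rewrite mulmxA. Qed.

Let WWS : W *m (W^T *m Sig) = 1%:M.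
Proof. exact: mulmx1C. Qed.

Let den_gt0 (i : nat) l : 0 < 1 + i%:R * lam l.
Proof. by rewrite ltr_pwDl// mulr_ge0. Qed.

Definition Cseq_eig (i : nat) (l : 'I_n) : R := lam l / (1 + i%:R * lam l).

Let eig_gt0 i l : 0 < 1 + Cseq_eig i l.
Proof. by rewrite ltr_pwDl// divr_ge0// ltW. Qed.

(** For a positive eigenvalue the recursion adds 1 to the reciprocal at each step; a zero eigenvalue
    stays zero. *)
Let Cseq_eig_rec i l : Cseq_eig i.+1 l = Cseq_eig i l / (1 + Cseq_eig i l).
Proof.
rewrite /Cseq_eig -natr1; have := den_gt0 i l; have := den_gt0 i.+1 l.
rewrite -natr1 => d1 d0; field.
by apply/andP; split; apply: lt0r_neq0; lra.
Qed.

(** The candidate inverse is checked on one side only, where the inner factors [W^T *m Sig *m W]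
    collapse; for square matrices this already gives invertibility and identifies the inverse. *)
Let invmx_diag (D : 'I_n -> R) : (forall l, 0 < D l) ->
  invmx (Sig *m W *m diag_mx (\row_l D l) *m (W^T *m Sig)) =
  W *m diag_mx (\row_l (D l)^-1) *m W^T.
Proof.
move=> D0; set M := (X in invmx X); set N := RHS.
have MN : M *m N = 1%:M.
  rewrite /M /N -!mulmxA (mulmxA Sig W) (mulmxA W^T Sig).
  rewrite (mulmxA (W^T *m Sig) W) W_orth mul1mx (mulmxA (diag_mx _) (diag_mx _)).
  rewrite mulmx_diag (_ : diag_mx _ = 1%:M) ?mul1mx//.
  rewrite -diag_const_mx; congr diag_mx; apply/rowP => l.
  by rewrite !mxE divff// gt_eqF.
by have [uM _] := mulmx1_unit MN; rewrite -[LHS]mulmx1 -MN mulKmx.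
Qed.

Let add_diag (D : 'I_n -> R) :
  Sig *m W *m diag_mx (\row_l D l) *m (W^T *m Sig) + Sig =
  Sig *m W *m diag_mx (\row_l (1 + D l)) *m (W^T *m Sig).
Proof.
rewrite -[X in _ + X = _](_ : Sig *m W *m 1%:M *m (W^T *m Sig) = Sig).
  rewrite -mulmxDl -mulmxDr -diag_const_mx -linearD /=; congr (_ *m diag_mx _ *m _).
  by apply/rowP => l; rewrite !mxE addrC.
by rewrite mulmx1 mulmxA SWW mul1mx.
Qed.

(** The base case is the eigenvector equation read column by column. In the inductive step an
    eigenvalue [m] becomes [1 - (1 + m)^-1 = m / (1 + m)]. *)
Lemma Cseq_diag i :
  Cseq C0 Sig i = Sig *m W *m diag_mx (\row_l Cseq_eig i l) *m (W^T *m Sig).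
Proof.
elim: i => [|i IHi] /=.
  rewrite -[LHS]mulmx1 -WWS mulmxA; congr (_ *m _).
  apply/matrixP => a l; rewrite mul_mx_diag !mxE /Cseq_eig mul0r addr0 divr1.
  have /matrixP/(_ a 0) := C0_eig l; rewrite !mxE mulrC => e.
  transitivity (\sum_j C0 a j * col l W j 0); first by apply: eq_bigr => j _; rewrite mxE.
  by rewrite e; congr (_ * _); apply: eq_bigr => j _; rewrite mxE.
rewrite IHi add_diag invmx_diag//.
rewrite -[X in X - _](_ : Sig *m W *m 1%:M *m (W^T *m Sig) = Sig); last first.
  by rewrite mulmx1 mulmxA SWW mul1mx.
rewrite -!mulmxA -!mulmxBr (mulmxA Sig W) !mulmxA -mulmxBl.
rewrite -!mulmxA -mulmxBl -mulmxA; congr (_ *m (_ *m (_ *m _))).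
rewrite -diag_const_mx -linearB /=; congr diag_mx; apply/rowP => l.
rewrite !mxE Cseq_eig_rec; have := eig_gt0 i l; set m := Cseq_eig i l => m0.
by field; rewrite gt_eqF.
Qed.

Lemma Mt_diag i :
  Mt C0 Sig i = Sig *m W *m diag_mx (\row_l (1 + Cseq_eig i l)^-1) *m W^T.
Proof. by rewrite /Mt Cseq_diag add_diag invmx_diag// !mulmxA. Qed.

Lemma theta_coord {T : Type} {J : nat} (th0 : 'I_J -> 'cV[R]_n)
    (eps : nat -> 'I_J -> T -> 'cV[R]_n) i j w l :
  (W^T *m theta C0 Sig th0 eps i j w) l 0 =
  ((W^T *m th0 j) l 0 + lam l * \sum_(k < i) ((col l W)^T *m eps k j w) 0 0)
    / (1 + i%:R * lam l).
Proof.
elim: i => [|i IHi]; first by rewrite /= big_ord0 mulr0 mul0r !addr0 divr1.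
(* [Mt] acts on coordinate [l] as multiplication by [(1 + i lam) / (1 + (i+1) lam)], and the noise
   receives the complementary weight [lam / (1 + (i+1) lam)]. *)
have WM : W^T *m Mt C0 Sig i = diag_mx (\row_l (1 + Cseq_eig i l)^-1) *m W^T.
  by rewrite Mt_diag !mulmxA W_orth mul1mx.
have WMv v : (W^T *m (Mt C0 Sig i *m v)) l 0 = (1 + Cseq_eig i l)^-1 * (W^T *m v) l 0.
  by rewrite mulmxA WM -mulmxA mul_diag_mx mxE [X in X * _]mxE.
rewrite /= mulmxDr mulmxBl mul1mx mulmxBr.
rewrite mxE WMv IHi [X in _ + X]mxE [X in _ + (_ + X)]mxE WMv.
have -> : (W^T *m eps i j w) l 0 = ((col l W)^T *m eps i j w) 0 0.
  by rewrite !mxE; apply: eq_bigr => a _; rewrite !mxE.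
rewrite big_ord_recr /= /Cseq_eig -natr1.
have := den_gt0 i l; have := den_gt0 i.+1 l; have := lam_ge0 l.
rewrite -natr1 => l0 d1 d0; field.
by apply/andP; split; apply: lt0r_neq0; lra.
Qed.

End idealized_misfit.

(** * Estimates for the projected coordinates *)

(** Expresses a projection through the scalars [w_l^T v], the coordinates for which [theta_coord]
    has a closed form. *)
Lemma proj_blockE {R : realType} {n : nat} (Sig W : 'M[R]_n) lo hi (v : 'cV[R]_n) :
  proj_block Sig W lo hi *m v =
  \sum_(l < n | (lo <= l < hi)%N) (W^T *m v) l 0 *: (Sig *m col l W).
Proof.
rewrite /proj_block -mulmxA mulmx_suml mulmx_sumr; apply: eq_bigr => l _.
have -> : (W^T *m v) l 0 = ((col l W)^T *m v) 0 0.
  by rewrite !mxE; apply: eq_bigr => a _; rewrite !mxE.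
by rewrite scalemxAr -mulmxA {1}[(col l W)^T *m v]mx11_scalar mul_mx_scalar.
Qed.

Lemma expectation_affine_sum {d} {T : measurableType d} {R : realType}
    (P : probability T R) {I : Type} (s : seq I) (p : pred I) (a b m : I -> R)
    (Y : I -> T -> R) :
  (forall l, Y l \in Lfun P 1) -> (forall l, 'E_P[Y l] = (m l)%:E)%E ->
  ('E_P[fun w => (\sum_(l <- s | p l) (a l + b l * Y l w))%R] =
   (\sum_(l <- s | p l) (a l + b l * m l))%:E)%E.
Proof.
move=> Y1 EY.
have Z1 l : cst (a l) \+ b l \o* Y l \in Lfun P 1.
  by rewrite rpredD//= ?Lfun_cst ?Lfun_scale.
have EZ l : ('E_P[(cst (a l) \+ b l \o* Y l)%R] = (a l + b l * m l)%:E)%E.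
  by rewrite expectationD ?Lfun_cst ?Lfun_scale// expectation_cst expectationZl// EY.
have S1 s' : (fun w => \sum_(l <- s' | p l) (a l + b l * Y l w)) \in Lfun P 1.
  have -> : (fun w => \sum_(l <- s' | p l) (a l + b l * Y l w)) =
      \sum_(l <- s' | p l) (cst (a l) \+ b l \o* Y l).
    apply/funext => w; rewrite fct_sumE; apply: eq_bigr => l _.
    by rewrite /= mulrC.
  by rewrite rpred_sum.
elim: s => [|l s IHs].
  rewrite big_nil -[RHS](expectation_cst P); congr ('E_P[_])%E.
  by apply/funext => w; rewrite big_nil.
rewrite big_cons; case: ifP => pl; last first.
  by rewrite -IHs; congr ('E_P[_])%E; apply/funext => w; rewrite big_cons pl.
rewrite EFinD -EZ -IHs -expectationD//; congr ('E_P[_])%E.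
by apply/funext => w; rewrite big_cons pl /= mulrC.
Qed.

Lemma eucl_norm_measurable {d} {T : measurableType d} {R : realType} {n : nat}
    (X : T -> 'cV[R]_n) :
  (forall c, measurable_fun setT (fun w => X w c 0)) ->
  measurable_fun setT (fun w => eucl_norm (X w)).
Proof.
move=> mX; rewrite /eucl_norm.
apply: (measurableT_comp (f := fun x : R => Num.sqrt x)).
  by apply: continuous_measurable_fun; exact: sqrt_continuous.
by apply: measurable_sum => c; exact: measurable_funX.
Qed.

(* AM-GM, [2 `|x| <= i^{-1/2} + i^{1/2} x ^+ 2], replaces Jensen's inequality
   for the square root in [E `|x| <= sqrt (E x ^+ 2)]. *)
Lemma misfit_coord_bound {R : realType} (x S lam : R) (i : nat) :
  0 < lam -> (0 < i)%N ->
  `|(x + lam * S) / (1 + i%:R * lam)| <=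
  (1 + x ^+ 2 / lam ^+ 2) / Num.sqrt i%:R + Num.sqrt i%:R / i%:R ^+ 2 * S ^+ 2.
Proof.
move=> lam0 i0.
have i1 : 1 <= i%:R :> R by rewrite ler1n.
set s := Num.sqrt i%:R.
have si : i%:R = s ^+ 2 :> R by rewrite sqr_sqrtr.
have s0 : 0 < s by rewrite sqrtr_gt0 ltr0n.
have s1 : 1 <= s by rewrite -[leLHS]sqrtr1 ler_wsqrtr.
rewrite {}si; set q := `|_|.
(* Uses [(a + b)^2 <= 2 (a^2 + b^2)] in the numerator and drops the 1 from the denominator, which is
   where [lam > 0] enters. *)
have q2 : q ^+ 2 <= 2 * (x ^+ 2 / lam ^+ 2 + S ^+ 2) / s ^+ 4.
  rewrite /q real_normK ?num_real// expr_div_n.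
  have -> : 2 * (x ^+ 2 / lam ^+ 2 + S ^+ 2) / s ^+ 4 =
      2 * (x ^+ 2 + (lam * S) ^+ 2) / (s ^+ 2 * lam) ^+ 2.
    by field; rewrite !gt_eqF.
  apply: ler_pM.
  - exact: sqr_ge0.
  - by rewrite invr_ge0 sqr_ge0.
  - rewrite -subr_ge0.
    have -> : 2 * (x ^+ 2 + (lam * S) ^+ 2) - (x + lam * S) ^+ 2 = (x - lam * S) ^+ 2 by ring.
    exact: sqr_ge0.
  - have sl : 0 < s ^+ 2 * lam by rewrite mulr_gt0 ?exprn_gt0.
    have sl1 : 0 < 1 + s ^+ 2 * lam by rewrite ltr_pwDl// ltW.
    rewrite lef_pV2 ?posrE ?exprn_gt0// ler_pXn2r ?nnegrE ?ltW//.
    by rewrite ltrDr.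
have amgm : q <= s^-1 / 2 + s * q ^+ 2 / 2.
  rewrite -subr_ge0.
  have -> : s^-1 / 2 + s * q ^+ 2 / 2 - q = (s * q - 1) ^+ 2 / (2 * s).
    by field; rewrite gt_eqF.
  by rewrite divr_ge0 ?sqr_ge0// mulr_ge0 ?ltW.
apply: (le_trans amgm).
set A := x ^+ 2 / lam ^+ 2 in q2 *.
have A0 : 0 <= A by rewrite divr_ge0 ?sqr_ge0.
(* The initial-value term decays like [s^-3]; it is weakened to [s^-1], as [s >= 1], to match the
   AM-GM term. *)
have : s * q ^+ 2 / 2 <= A / s + s / (s ^+ 2) ^+ 2 * S ^+ 2.
  apply: (@le_trans _ _ (s * (2 * (A + S ^+ 2) / s ^+ 4) / 2)).
    by rewrite ler_pM2r ?invr_gt0// ler_pM2l.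
  have -> : s * (2 * (A + S ^+ 2) / s ^+ 4) / 2 = A / s ^+ 3 + s / (s ^+ 2) ^+ 2 * S ^+ 2.
    by field; rewrite gt_eqF.
  rewrite lerD2r ler_wpM2l// lef_pV2 ?posrE ?exprn_gt0//.
  by rewrite exprS ler_peMr ?exprn_ege1 // ltW.
have : 0 < s^-1 by rewrite invr_gt0.
rewrite mulrDl mul1r; lra.
Qed.

(** * Decay on the positive block and invariance on the other two *)

Theorem theorem4p7 (R : realType) (dsp : measure_display) (T : measurableType dsp)
  (P : probability T R) (n d J : nat)
  (H : 'M[R]_(n, d)) (Sig : 'M[R]_n) (y : 'cV[R]_n)
  (v0 : 'I_J -> 'cV[R]_d) (eps : nat -> 'I_J -> T -> 'cV[R]_n)
  (h r : nat) (W : 'M[R]_n) :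
  h = \rank H ->
  Sig^T = Sig ->
  (forall u : 'cV[R]_n, u != 0 -> 0 < (u^T *m Sig *m u) 0 0) ->
  (2 <= J)%N ->
  iid_gaussian P Sig (fun k : nat * 'I_J => eps k.1 k.2) ->
  let C0 := H *m emp_cov v0 *m H^T in
  (* Sigma-orthonormal basis w_1..w_n (columns of W) *)
  W^T *m Sig *m W = 1%:M ->
  (* simultaneous generalized eigenvectors of (C_i, Sigma) for all i *)
  (forall (i : nat) (l : 'I_n), exists lam : R,
      Cseq C0 Sig i *m col l W = lam *: (Sig *m col l W)) ->
  (r <= h)%N ->
  (forall l : 'I_n, (l < r)%N ->
      exists2 lam : R, 0 < lam & C0 *m col l W = lam *: (Sig *m col l W)) ->
  (forall l : 'I_n, (r <= l)%N -> C0 *m col l W = 0 *: (Sig *m col l W)) ->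
  (forall l : 'I_n, (l < h)%N -> ((col l W)^T <= (invmx Sig *m H)^T)%MS) ->
  (forall l : 'I_n, (h <= l)%N -> H^T *m col l W = 0) ->
  let th := theta C0 Sig (fun j => H *m v0 j - y) eps in
  let Pt := proj_block Sig W 0 r in
  let Qt := proj_block Sig W r h in
  let Nt := proj_block Sig W h n in
  forall j : 'I_J,
    [/\ (exists (K : R) (N : nat), forall i : nat, (N <= i)%N ->
           ('E_P[fun w => eucl_norm (Pt *m th i j w)]
              <= (K / Num.sqrt (i%:R)) %:E)%E),
        (forall (i : nat) (w : T), Qt *m th i j w = Qt *m th 0 j w) &
        (forall (i : nat) (w : T), Nt *m th i j w = Nt *m th 0 j w)].
Proof.
move=> _ _ Sig_gt0 _ iid C0 W_orth _ rh eig_pos eig_zero _ _ th Pt Qt Nt j.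
(* A single eigenvalue function for [C0], positive below [r] and zero from [r] on; it determines the
   eigenvalues of all later [Cseq]. *)
have /choice[lam lamP] : forall l : 'I_n, exists c : R,
    [/\ C0 *m col l W = c *: (Sig *m col l W), 0 <= c,
        ((l < r)%N -> 0 < c) & ((r <= l)%N -> c = 0)].
  move=> l.
  have [lr|rl] := ltnP l r; last by exists 0; split => //; exact: eig_zero.
  by have [m m0 mE] := eig_pos l lr; exists m; split => //; exact: ltW.
have lam_ge0 l : 0 <= lam l by have [] := lamP l.
have C0_eig l : C0 *m col l W = lam l *: (Sig *m col l W) by have [] := lamP l.
have coordE := theta_coord C0 Sig W lam W_orth lam_ge0 C0_eig
  (fun j => H *m v0 j - y) eps.
(* Any block starting at [r] or later sees only zero eigenvalues, so its coordinates never move;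
   this covers both (b) and (c). *)
have block_cst lo hi i w : (r <= lo)%N ->
    proj_block Sig W lo hi *m th i j w = proj_block Sig W lo hi *m th 0 j w.
  move=> rlo; rewrite !proj_blockE; apply: eq_bigr => l /andP[lol _].
  have lam0 : lam l = 0 by have [_ _ _] := lamP l; apply; exact: leq_trans lol.
  by rewrite /th !coordE lam0 !mul0r !mulr0 !addr0 !divr1.
split; [|by move=> i w; exact: block_cst|by move=> i w; exact: block_cst].
have col_neq0 l : col l W != 0.
  apply/eqP => Wl0; have /(congr1 (col l)) := W_orth.
  rewrite colE -mulmxA -colE Wl0 mulmx0 => /matrixP/(_ l 0)/eqP.
  by rewrite !mxE eqxx eq_sym oner_eq0.
pose Z l k w : R := ((col l W)^T *m eps k j w) 0 0.
pose S l i w := \sum_(k < i) Z l k w.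
pose sd l : R := Num.sqrt (((col l W)^T *m Sig *m col l W) 0 0).
(* The second moment of [w_l^T eps], the same at every step. It is kept unevaluated; finiteness,
   checked in [EZ2], makes [fine] faithful. *)
pose m l := fine (\int[normal_prob 0 (sd l)]_x (x ^+ 2)%:E)%E.
have Z2 l k : Z l k \in Lfun P 2%:E.
  exact: (gaussian_lin_Lfun2 _ _ _ Sig_gt0 iid (k, j)).
have EZ l k : ('E_P[Z l k] = 0)%E.
  exact: (gaussian_lin_expectation _ _ _ Sig_gt0 iid (k, j)).
have EZ2 l k : ('E_P[(Z l k ^+ 2)%R] = (m l)%:E)%E.
  apply: etrans (gaussian_lin_moment2 _ _ _ iid (k, j) _ (col_neq0 l)) _.
  rewrite fineK// ge0_fin_numE.
    by apply: normal_prob_moment2_lty; rewrite sqrtr_gt0 Sig_gt0.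
  by apply: integral_ge0 => x _; rewrite lee_fin sqr_ge0.
have cZ l k k' : k != k' -> (covariance P (Z l k) (Z l k') = 0)%E.
  (* The family is indexed by pairs (step, particle), so distinct steps of the fixed particle [j]
     are distinct indices. *)
  move=> kk'; apply: (gaussian_lin_covariance _ _ _ Sig_gt0 iid (k, j) (k', j)) => //.
  by apply: contra kk' => /eqP[->].
have ES l i : ('E_P[fun w => (S l i w ^+ 2)%R] = (i%:R * m l)%:E)%E.
  by apply: (expectation_sqr_sum P (Z l)) => //; exact: cZ.
have S2 l i : S l i \in Lfun P 2%:E by exact: Lfun2_sum.
have SS1 l i : (fun w => S l i w ^+ 2) \in Lfun P 1 by exact: Lfun2_mul_Lfun1.
have mS l i : measurable_fun setT (S l i).
  by move/sub_Lfun_mfun: (S2 l i); rewrite inE.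
pose x0 l := (W^T *m (H *m v0 j - y)) l 0.
have th_coord i w l : (W^T *m th i j w) l 0 =
    (x0 l + lam l * S l i w) / (1 + i%:R * lam l) by exact: coordE.
pose B l := \sum_(c < n) `|(Sig *m col l W) c 0|.
have B0 l : 0 <= B l by exact: sumr_ge0.
pose in_r (l : 'I_n) := (0 <= l < r)%N.
(* Each [l] contributes [B l] times the coordinate bound, in which [S ^+ 2] has mean [i m], giving
   [(s / i^2) i m = m / s]. Starting at 1 keeps [s] nonzero. *)
exists (\sum_(l < n | in_r l) B l * (1 + x0 l ^+ 2 / lam l ^+ 2 + m l)), 1%N => i i0.
set s := Num.sqrt i%:R.
have si : i%:R = s ^+ 2 :> R by rewrite sqr_sqrtr.
have s0 : 0 < s by rewrite sqrtr_gt0 ltr0n.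
pose a l := B l * ((1 + x0 l ^+ 2 / lam l ^+ 2) / s).
pose b l := B l * (s / i%:R ^+ 2).
have a0 l : 0 <= a l.
  by rewrite mulr_ge0// divr_ge0 ?(ltW s0)// addr_ge0// divr_ge0 ?sqr_ge0.
have b0 l : 0 <= b l by rewrite mulr_ge0// divr_ge0 ?(ltW s0)// sqr_ge0.
have bound w : eucl_norm (Pt *m th i j w) <=
    \sum_(l < n | in_r l) (a l + b l * S l i w ^+ 2).
  apply: (le_trans (ler_eucl_norm_sum _)); rewrite proj_blockE.
  apply: (@le_trans _ _ (\sum_(l < n | in_r l) B l * `|(W^T *m th i j w) l 0|)).
    under [leRHS]eq_bigr do rewrite mulr_suml.
    rewrite exchange_big; apply: ler_sum => c _.
    rewrite summxE; apply: (le_trans (ler_norm_sum _ _ _)).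
    by apply: ler_sum => l _; rewrite mxE normrM mulrC.
  apply: ler_sum => l /andP[_ lr].
  rewrite /a /b -[_ * _ * S l i w ^+ 2]mulrA -mulrDr ler_wpM2l// th_coord.
  apply: misfit_coord_bound => //.
  by have [_ _ + _] := lamP l; apply.
(* Measurability is read off the closed form of the coordinates, where the only random term is
   [S]. *)
have mP c : measurable_fun setT (fun w => (Pt *m th i j w) c 0).
  have -> : (fun w => (Pt *m th i j w) c 0) = fun w =>
      \sum_(l < n) (if in_r l then
        (x0 l + lam l * S l i w) / (1 + i%:R * lam l) * (Sig *m col l W) c 0 else 0).
    apply/funext => w; rewrite proj_blockE summxE -big_mkcond.
    by apply: eq_bigr => l _; rewrite mxE th_coord.
  apply: measurable_sum => l; case: (in_r l) => //.
  apply: measurable_funM => //; apply: measurable_funM => //.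
  by apply: measurable_funD => //; exact: measurable_funM.
apply: (@le_trans _ _
    'E_P[fun w => (\sum_(l < n | in_r l) (a l + b l * S l i w ^+ 2))%R])%E.
  apply: expectation_le.
  - exact: eucl_norm_measurable.
  - have -> : (fun w => \sum_(l < n | in_r l) (a l + b l * S l i w ^+ 2)) =
        fun w => \sum_(l < n) (if in_r l then a l + b l * S l i w ^+ 2 else 0).
      by apply/funext => w; rewrite -big_mkcond.
    apply: measurable_sum => l; case: (in_r l) => //.
    apply: measurable_funD => //; apply: measurable_funM => //.
    exact: measurable_funX.
  - by move=> w; exact: sqrtr_ge0.
  - by move=> w; apply: sumr_ge0 => l _; rewrite addr_ge0// mulr_ge0// sqr_ge0.
  - exact: aeW.
rewrite (expectation_affine_sum P _ _ a b (fun l => i%:R * m l)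
  (fun l w => S l i w ^+ 2))//.
rewrite lee_fin mulr_suml; apply: ler_sum => l _.
rewrite /a /b si le_eqVlt; apply/orP; left; apply/eqP.
by move: (x0 l ^+ 2 / lam l ^+ 2) => A; field; rewrite gt_eqF.
Qed.
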